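(* Consider a linear finite-field deterministic network on a directed acyclic graph $\mathcal{G}=(\mathcal{V},\mathcal{E})$ with $\mathcal{V}=\{1,\ldots,N,d\}$, in which each of the nodes $1,\ldots,N$ has an independent message for the single destination $d$. The capacity region $\mathcal{C}$ of this network is the set of all rate tuples $(R_1,\ldots,R_N)$ of non-negative reals satisfying \[ \sum_{i\in\mathcal{S}} R_i \le \operatorname{rank}\{\mathbf{G}_{\mathcal{S},\mathcal{S}^c}\} \quad \text{for all } \mathcal{S}\subseteq\{1,\ldots,N\}, \] where $\mathcal{S}^c=\mathcal{V}\setminus\mathcal{S}$ and the rank is taken over $\mathbb{F}_2$.
   Context: Network model: fix an integer $q\ge 1$ and integers $0\le n_{i,j}\le q$ for each edge $(i,j)\in\mathcal{E}$. At each discrete time, every node $i$ transmits a vector $\mathbf{x}_i\in\mathbb{F}_2^q$, and every node $j$ receives $\mathbf{y}_j=\sum_{i:(i,j)\in\mathcal{E}} \mathbf{S}^{q-n_{i,j}}\mathbf{x}_i\in\mathbb{F}_2^q$ (arithmetic over $\mathbb{F}_2$), where $\mathbf{S}$ is the $q\times q$ down-shift matrix (ones on the first subdiagonal, zeros elsewhere). Thus the input $\mathbf{x}_i$ is common to all outgoing edges of $i$ (broadcast) and received signals superimpose (interference). Cut transfer matrix: for $i\in\mathcal{V}$ let $\mathcal{N}(i)=\{j:(i,j)\in\mathcal{E}\}$ and $\mathcal{P}(j)=\{i:(i,j)\in\mathcal{E}\}$. For $\mathcal{S}\subseteq\mathcal{V}$ with complement $\mathcal{S}^c$, let $\beta_{\rm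 in}(\mathcal{S})=\{i\in\mathcal{S}:\mathcal{N}(i)\cap\mathcal{S}^c\ne\emptyset\}$ and $\beta_{\rm out}(\mathcal{S})=\{j\in\mathcal{S}^c:\mathcal{P}(j)\cap\mathcal{S}\ne\emptyset\}$. $\mathbf{G}_{\mathcal{S},\mathcal{S}^c}$ is the matrix over $\mathbb{F}_2$ of the linear map from the stacked inputs $(\mathbf{x}_i)_{i\in\beta_{\rm in}(\mathcal{S})}$ to the stacked outputs $(\mathbf{y}_j)_{j\in\beta_{\rm out}(\mathcal{S})}$ (contributions from nodes outside $\mathcal{S}$ ignored), i.e. the block matrix whose $(j,i)$ block is $\mathbf{S}^{q-n_{i,j}}$ if $(i,j)\in\mathcal{E}$ and $0$ otherwise (empty matrix, rank $0$, if there are no such nodes). Codes and capacity: for an integer $T\ge1$, node $i\in\{1,\ldots,N\}$ has message set $\mathcal{W}_i=\{1,\ldots,\lceil 2^{TR_i}\rceil\}$. A $(T,R_1,\ldots,R_N)$ code consists of strictly causal encoders $f_i^{[t]}:\mathcal{W}_i\times\mathbb{F}_2^{q(t-1)}\to\mathbb{F}_2^q$, $t=1,\ldots,T$, with $\mathbf{x}_i[t]=f_i^{[t]}(w_i,\mathbf{y}_i[1],\ldots,\mathbf{y}_i[t-1])$, and a decoder $g:\mathbb{F}_2^{Tq}\to\mathcal{W}_1\times\cdots\times\mathcal{W}_N$ applied to $(\mathbf{y}_d[1],\ldots,\mathbf{y}_d[T])$. With messages $W_i$ independent and uniform on $\mathcal{W}_i$, the error probability is the probability that the decoded tuple differs from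 $(W_1,\ldots,W_N)$. A rate tuple is achievable if there is a sequence of such codes with error probability tending to $0$ as $T\to\infty$; the capacity region is the closure of the set of achievable rate tuples. *)

(* Defs.v *)
From HB Require Import structures.
From mathcomp Require Import all_boot all_order all_algebra.
From mathcomp Require Import all_classical all_reals all_analysis.
Set Implicit Arguments. Unset Strict Implicit. Unset Printing Implicit Defensive.
Import Order.TTheory GRing.Theory Num.Theory.
Local Open Scope ring_scope.
Local Open Scope classical_set_scope.
Import numFieldNormedType.Exports.

(* Nodes: V = 'I_N.+1; node k < N is source k+1 of the paper, ord_max is d. *)
Definition node (N : nat) := 'I_N.+1.
Definition dest (N : nat) : node N := ord_max.
Definition src (N : nat) (i : 'I_N) : node N := widen_ord (leqnSn N) i.

Definition acyclic (N : nat) (E : rel (node N)) : Prop :=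
  forall i j, E i j -> ~~ connect E j i.

Definition shiftM (q : nat) : 'M['F_2]_q :=
  \matrix_(a < q, b < q) ((nat_of_ord a == (nat_of_ord b).+1)%N)%:R.

(* Cut transfer matrix G_{S,S^c}, padded with zero block rows/columns for
   nodes outside beta_out(S) / beta_in(S) (this does not change the rank). *)
Definition cutmx (N q : nat) (E : rel (node N)) (n : node N -> node N -> nat)
    (SV : {set node N}) :
    'M['F_2]_(\sum_(j < N.+1) q, \sum_(i < N.+1) q) :=
  \mxblock_(j < N.+1, i < N.+1)
    (if [&& i \in SV, j \notin SV & E i j] then shiftM q ^+ (q - n i j)
     else (0 : 'M['F_2]_(q, q))).

Definition srcset (N : nat) (S : {set 'I_N}) : {set node N} := [set src i | i in S].

Section Codes.
Variable R : realType.

Definition msize (T : nat) (r : R) : nat := `|Num.ceil (2 `^ (T%:R * r))|%N.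

Definition msgs (N : nat) (T : nat) (Rt : 'rV[R]_N) :=
  {dffun forall i : 'I_N, 'I_(msize T (Rt 0 i))}.

(* A (T, R_1..R_N) code; time index t : 'I_T is 0-based, the encoder at time
   t sees the t previous received vectors. *)
Record code (N q T : nat) (Rt : 'rV[R]_N) := Code {
  enc : forall (i : 'I_N) (t : 'I_T),
          'I_(msize T (Rt 0 i)) -> ('I_t -> 'cV['F_2]_q) -> 'cV['F_2]_q;
  dec : ('I_T -> 'cV['F_2]_q) -> msgs T Rt
}.

Arguments enc {N q T Rt} c i t.
Arguments dec {N q T Rt} c.

Variables (N q : nat) (E : rel (node N)) (n : node N -> node N -> nat).

Definition receive (x : node N -> 'cV['F_2]_q) (j : node N) : 'cV['F_2]_q :=
  \sum_(i | E i j) (shiftM q ^+ (q - n i j)) *m x i.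

Section Run.
Variables (T : nat) (Rt : 'rV[R]_N) (c : @code N q T Rt) (w : msgs T Rt).

Definition y0 : node N -> 'cV['F_2]_q := fun _ => 0.

(* Transmitted vector of node v given the history h of received signals
   (h has one entry per past time step). The destination transmits 0. *)
Definition transmit (h : seq (node N -> 'cV['F_2]_q)) (v : node N) : 'cV['F_2]_q :=
  match unlift (dest N) v, insub (size h) : option 'I_T with
  | Some i, Some t => enc c i t (w i) (fun s : 'I_t => nth y0 h s v)
  | _, _ => 0
  end.

Fixpoint hist (t : nat) : seq (node N -> 'cV['F_2]_q) :=
  match t with
  | 0 => [::]
  | t'.+1 => let h := hist t' in rcons h (receive (transmit h))
  end.

Definition dest_output : 'I_T -> 'cV['F_2]_q :=
  fun t => nth y0 (hist T) t (dest N).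
End Run.

(* Error probability with independent uniform messages. *)
Definition err_prob (T : nat) (Rt : 'rV[R]_N) (c : @code N q T Rt) : R :=
  (#|[set w : msgs T Rt | dec c (dest_output c w) != w]|%:R
   / #|{: msgs T Rt}|%:R).

Definition achievable (Rt : 'rV[R]_N) : Prop :=
  (forall i, 0 <= Rt 0 i) /\
  exists c : forall T : nat, @code N q T Rt,
    (fun T : nat => err_prob (c T.+1)) @ \oo --> (0 : R).

Definition capacity_region : set 'rV[R]_N := closure achievable.

End Codes.

(* Main.v *)
(** Converse: fix the messages outside a cut S. The signals crossing the cut
    determine, by induction on time, everything received outside S, hence the
    decoded tuple; they take at most 2 ^ (T * rank) values, so at most that many
    message tuples inside S are decoded correctly.

    Achievability: let every node apply, at each time, an independent random
    function of all that it knows. For messages w <> w', let A_t be the set of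
    sources that can tell w from w' at time t: it is nondecreasing and contains
    the set D of sources whose messages differ. At each step, the event that no
    node outside A_t starts to distinguish has probability at most
    2 ^ - rank(A_t), and otherwise A_t grows, which happens at most N times.
    So the potential kap ^ |A_t| * al ^ (T - t), which vanishes as soon as d
    distinguishes, is a supermartingale whenever kap + 2 ^ - rank(A) <= al for all
    A containing D. Choosing the functions greedily, one time step after the
    other, gives a code whose error probability is at most the sum over w' <> w
    of the initial potentials, up to a factor kap ^ -N and averaged over w; for
    (1 - delta) R this tends to 0 with al = 2 ^ - ((1 - delta/2) * sum_D R)
    and kap = al - 2 ^ - sum_D R. *)

Require Import Defs.
From HB Require Import structures.
From mathcomp Require Import all_boot all_order all_algebra.
From mathcomp Require Import all_classical all_reals all_analysis.
From mathcomp Require Import ring lra.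
Import Order.TTheory GRing.Theory Num.Theory.
Local Open Scope ring_scope.
Local Open Scope classical_set_scope.
Set Implicit Arguments. Unset Strict Implicit. Unset Printing Implicit Defensive.
Import numFieldNormedType.Exports.

(** * Counting with finite linear maps *)

(** In the factorisation through [row_base M] and [col_base M] the first map is onto and the second
    injective. *)
Lemma card_mulmx_image (F : finFieldType) (a b : nat) (M : 'M[F]_(a, b)) :
  #|[set M *m v | v : 'cV[F]_b]%SET| = (#|F| ^ \rank M)%N.
Proof.
have [C CK] := row_fullP (col_base_full M).
have [B BK] := row_freeP (row_base_free M).
have -> : [set M *m v | v : 'cV[F]_b]%SET
    = [set col_base M *m v | v : 'cV[F]_(\rank M)]%SET.
  apply/setP => y; apply/imsetP/imsetP => -[v _ ->].
    by exists (row_base M *m v) => //; rewrite mulmxA mulmx_base.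
  exists (B *m v) => //.
  transitivity (col_base M *m row_base M *m (B *m v)); last by rewrite mulmx_base.
  by rewrite -mulmxA (mulmxA (row_base M)) BK mul1mx.
rewrite card_imset; last first.
  have colK : cancel (mulmx (col_base M)) (mulmx C : _ -> 'cV[F]_(\rank M)).
    by move=> u; rewrite mulmxA CK mul1mx.
  exact: can_inj colK.
by rewrite card_mx muln1.
Qed.

(** With a section [s] of [f], sending (x, y) to x + s y is injective on kernel times image. *)
Lemma card_kernel_image (K : finType) (V Y : finZmodType) (f : {ffun K -> V} -> Y) :
  {morph f : x y / (x + y)%R} ->
  (#|[set x | (f x == 0)%R]%SET| * #|[set f x | x : {ffun K -> V}]%SET|
   <= #|{ffun K -> V}|)%N.
Proof.
move=> fD; pose s y := odflt 0 [pick x | f x == y].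
have fs y : y \in [set f x | x : {ffun K -> V}]%SET -> f (s y) = y.
  case/imsetP => x _ ->; rewrite /s; case: pickP => [z /eqP //|/(_ x)].
  by rewrite eqxx.
rewrite -cardsX -(@card_in_imset _ _ (fun p : {ffun K -> V} * Y => p.1 + s p.2)) ?max_card //.
move=> [x y] [x' y'] /setXP[/=]; rewrite inE => /eqP kx iy.
case/setXP => /=; rewrite inE => /eqP kx' iy' e.
have := congr1 f e; rewrite !fD kx kx' !add0r !fs // => yy.
by move: e; rewrite yy => /addIr ->.
Qed.

(** * Signals crossing a cut *)

Section Cut.
Variables (N q : nat) (E : rel (node N)) (n : node N -> node N -> nat).

Definition cut_receive (A : {set node N}) (x : node N -> 'cV['F_2]_q) (j : node N) :
    'cV['F_2]_q :=
  \sum_(i in A | E i j) (shiftM q ^+ (q - n i j)) *m x i.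

Lemma mul_cutmx (A : {set node N}) (x : node N -> 'cV['F_2]_q) :
  cutmx q E n A *m \mxcol_i x i
  = \mxcol_j (if j \in A then 0 else cut_receive A x j).
Proof.
rewrite /cutmx mul_mxblock_mxrow; apply/mxcolP => j; rewrite !mxcolK.
case: ifPn => jA.
  by rewrite big1 // => i _; rewrite andbF mul0mx.
rewrite /cut_receive [RHS]big_mkcond /=; apply: eq_bigr => i _.
by case: ifP => _; rewrite ?mul0mx.
Qed.

Lemma eq_mul_cutmx (A : {set node N}) (x x' : node N -> 'cV['F_2]_q) :
  cutmx q E n A *m \mxcol_i x i = cutmx q E n A *m \mxcol_i x' i <->
  forall j, j \notin A -> cut_receive A x j = cut_receive A x' j.
Proof.
rewrite !mul_cutmx; split => [/mxcolP e j jA|e].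
  by have := e j; rewrite !mxcolK (negPf jA).
by apply/mxcolP => j; rewrite !mxcolK; case: ifPn => // /e.
Qed.

Lemma eq_cut_receive (A : {set node N}) (x x' : node N -> 'cV['F_2]_q) (j : node N) :
  {in A, x =1 x'} -> cut_receive A x j = cut_receive A x' j.
Proof. by move=> e; apply: eq_bigr => i /andP[/e ->]. Qed.

Lemma receive_split (A : {set node N}) (x : node N -> 'cV['F_2]_q) (j : node N) :
  receive E n x j = cut_receive A x j + cut_receive (~: A) x j.
Proof.
rewrite /receive (bigID (mem A)) /=; congr (_ + _); apply: eq_bigl => i.
  by rewrite andbC.
by rewrite inE andbC.
Qed.

End Cut.

(** * Counting message tuples; sources and destination *)

Lemma card_dffun_fix (I : finType) (T_ : I -> finType) (A : {set I})
    (w0 : {dffun forall i, T_ i}) :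
  #|[set w : {dffun forall i, T_ i} | [forall i in A, w i == w0 i]]%SET|
  = (\prod_(i in ~: A) #|T_ i|)%N.
Proof.
pose F i : pred (T_ i) := if i \in A then pred1 (w0 i) else predT.
transitivity #|(family F : simpl_pred {dffun forall i, T_ i})|.
  rewrite cardsE; apply: eq_card => w; rewrite inE.
  apply/forall_inP/familyP => [e i|e i iA].
    by rewrite /F; case: ifP => // /e; rewrite inE.
  by have := e i; rewrite /F iA.
rewrite card_family foldrE big_map big_enum /= [RHS]big_mkcond /=.
apply: eq_bigr => i _; rewrite inE /F; case: ifP => _ /=; first exact: card1.
exact: eq_card.
Qed.

Lemma card_dffun_prod (I : finType) (T_ : I -> finType) :
  #|{dffun forall i, T_ i}| = (\prod_i #|T_ i|)%N.
Proof. by rewrite card_dep_ffun foldrE big_map big_enum. Qed.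

Lemma src_inj (N : nat) : injective (@src N).
Proof. by move=> i j /(congr1 val) /= e; apply: val_inj. Qed.

Lemma mem_srcset (N : nat) (S : {set 'I_N}) (i : 'I_N) :
  (src i \in srcset S) = (i \in S).
Proof. by rewrite /srcset mem_imset //; exact: src_inj. Qed.

Lemma dest_notin_srcset (N : nat) (S : {set 'I_N}) : dest N \notin srcset S.
Proof.
apply/imsetP => -[i _ /(congr1 val) /= e].
by have := ltn_ord i; rewrite -e ltnn.
Qed.

Lemma unlift_src (N : nat) (i : 'I_N) : unlift (dest N) (src i) = Some i.
Proof.
have -> : src i = lift (dest N) i by apply: val_inj; rewrite /= /bump leqNgt ltn_ord.
exact: liftK.
Qed.

Lemma node_ind (N : nat) (P : node N -> Prop) :
  P (dest N) -> (forall i, P (src i)) -> forall v, P v.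
Proof.
move=> Pd Ps v; case: (unliftP (dest N) v) => [i ->|-> //].
suff -> : lift (dest N) i = src i by [].
by apply: val_inj; rewrite /= /bump leqNgt ltn_ord.
Qed.

(** * Runs of a code and the converse count *)

Section Run.
Variables (R : realType) (N q : nat) (E : rel (node N)) (n : node N -> node N -> nat).
Variables (T : nat) (Rt : 'rV[R]_N) (c : @Defs.code R N q T Rt).
Implicit Types w : msgs T Rt.

Definition signal w (t : nat) : node N -> 'cV['F_2]_q :=
  transmit c w (hist E n c w t).

Definition output w (t : nat) : node N -> 'cV['F_2]_q := receive E n (signal w t).

Lemma outputE w (t : nat) : output w t = receive E n (signal w t).
Proof. by []. Qed.

Lemma size_hist w (t : nat) : size (hist E n c w t) = t.
Proof. by elim: t => //= t IH; rewrite size_rcons IH. Qed.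

Lemma nth_hist w (t s : nat) :
  nth (@y0 N q) (hist E n c w t) s = if (s < t)%N then output w s else @y0 N q.
Proof.
elim: t => [|t IH]; first by rewrite nth_nil.
rewrite /= nth_rcons size_hist IH ltnS.
by case: ltngtP => // ->.
Qed.

Lemma signal_dest w (t : nat) : signal w t (dest N) = 0.
Proof. by rewrite /signal /transmit unlift_none. Qed.

Lemma signal_src w (t : 'I_T) (i : 'I_N) :
  signal w t (src i) = enc c (i := i) (t := t) (w i) (fun s : 'I_t => output w s (src i)).
Proof.
rewrite /signal /transmit unlift_src size_hist; case: insubP => [t' _ tt|]; last first.
  by rewrite ltn_ord.
move/val_inj: tt => ->; congr (enc _ _ _); apply: boolp.funext => s.
by rewrite nth_hist ltn_ord.
Qed.

Lemma dest_outputE w : dest_output E n c w = fun t => output w t (dest N).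
Proof. by apply: boolp.funext => t; rewrite /dest_output nth_hist ltn_ord. Qed.

Local Opaque hist transmit receive cutmx signal output.

Lemma cut_determines_output (S : {set 'I_N}) w w' :
  (forall i, i \notin S -> w i = w' i) ->
  (forall t : 'I_T, cutmx q E n (srcset S) *m \mxcol_i signal w t i
                  = cutmx q E n (srcset S) *m \mxcol_i signal w' t i) ->
  forall (t : nat) j, (t < T)%N -> j \notin srcset S -> output w t j = output w' t j.
Proof.
move=> ww cut; elim/ltn_ind => t IH j tT jS.
(* Senders outside the cut agree: the destination sends 0, and a source has the same message and, by
   induction, the same past receptions. *)
have e : {in ~: srcset S, signal w t =1 signal w' t}.
  elim/node_ind => [|i]; rewrite inE => vS.
    exact: etrans (signal_dest w t) (esym (signal_dest w' t)).
  have iS : i \notin S by rewrite -mem_srcset.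
  have := signal_src w' (Ordinal tT) i; have := signal_src w (Ordinal tT) i.
  rewrite (ww i iS) => /= -> ->; apply: (congr1 (@enc _ _ _ _ _ c i _ (w' i))).
  by apply: boolp.funext => -[s st]; apply: IH => //=; exact: ltn_trans st tT.
have /eq_mul_cutmx/(_ j jS) e' := cut (Ordinal tT).
rewrite outputE (receive_split E n (srcset S) (signal w t) j) e'.
by rewrite outputE (receive_split E n (srcset S) (signal w' t) j) (eq_cut_receive _ _ _ e).
Qed.

(** A correctly decoded [w] is recovered from its part outside [S] and the [T] signals crossing the
    cut, each of which lies in the image of the cut matrix. *)
Lemma card_correct_le (S : {set 'I_N}) :
  (#|[set w | dec c (dest_output E n c w) == w]%SET|
     * \prod_(i in S) msize T (Rt 0%R i)
   <= #|{: msgs T Rt}| * 2 ^ (\rank (cutmx q E n (srcset S)) * T))%N.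
Proof.
pose G := cutmx q E n (srcset S).
pose C := [set G *m v | v : 'cV['F_2]_(\sum_(i < N.+1) q)]%SET.
(* Any tuple would do for overwriting the messages in [S]; the decoder supplies one. *)
pose w0 := dec c (fun _ => 0%R).
pose W0 := [set w : msgs T Rt | [forall i in S, w i == w0 i]]%SET.
pose proj w : msgs T Rt := [ffun i => if i \in S then w0 i else w i].
pose crossing w : {ffun 'I_T -> 'cV['F_2]_(\sum_(j < N.+1) q)} :=
  [ffun t : 'I_T => G *m \mxcol_i signal w t i].
have projE w i : proj w i = if i \in S then w0 i else w i by exact: ffunE.
have crossingE w t : crossing w t = G *m \mxcol_i signal w t i by exact: ffunE.
move: proj crossing projE crossingE => proj crossing projE crossingE.
pose enc_cut w := (proj w, crossing w).
have inj : {in [set w | dec c (dest_output E n c w) == w]%SET &, injective enc_cut}.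
  move=> w w'; rewrite !inE => /eqP dw /eqP dw' e.
  have e1 : proj w = proj w' := congr1 fst e.
  have e2 : crossing w = crossing w' := congr1 snd e.
  rewrite -dw -dw'; congr (dec _ _); rewrite !dest_outputE.
  apply: boolp.funext => t; apply: (cut_determines_output (S := S)).
  - move=> i /negPf iS; have := projE w i; have := projE w' i.
    by rewrite iS e1 => -> ->.
  - by move=> s; rewrite -crossingE e2 crossingE.
  - exact: ltn_ord.
  - exact: dest_notin_srcset.
rewrite -(card_in_imset inj).
have sub : (enc_cut @: [set w | dec c (dest_output E n c w) == w]
            \subset finset.setX W0 [set f in ffun_on C])%SET.
  apply/fintype.subsetP => _ /imsetP[w _ ->]; rewrite inE /= !inE; apply/andP; split.
    by apply/forall_inP => i iS; rewrite projE iS.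
  by apply/ffun_onP => t; rewrite crossingE imset_f.
apply: leq_trans (leq_mul (subset_leq_card sub) (leqnn _)) _.
rewrite cardsX card_dffun_fix cardsE card_ffun_on card_mulmx_image card_Fp // card_ord.
rewrite card_dffun_prod [X in (_ <= X * _)%N](bigID (mem S)) /= -expnM.
under [in X in (_ <= X)%N]eq_bigr do rewrite card_ord.
under eq_bigl do rewrite inE.
by rewrite [X in (X <= _)%N]mulnC mulnA leqnn.
Qed.

End Run.

(** * One random step *)

Section RandomStep.
Variables (N q : nat) (E : rel (node N)) (n : node N -> node N -> nat).
Variable K : finType.

(** A single [g] serves all sources: when their keys differ, a uniform [g] gives them independent
    vectors. *)
Definition spread (g : {ffun K -> 'cV['F_2]_q}) (k : 'I_N -> K) (v : node N) :
    'cV['F_2]_q :=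
  if unlift (dest N) v is Some i then g (k i) else 0.

(** The tables that hide the difference form the kernel of the additive map [f], whose image
    contains that of the cut matrix. *)
Lemma card_confusing (k k' : 'I_N -> K) (A : {set 'I_N}) :
  injective k -> (forall i j, k i = k' j -> i = j) ->
  {in A, forall i, k i != k' i} ->
  (#|[set g | cutmx q E n (srcset A) *m \mxcol_v spread g k v
              == cutmx q E n (srcset A) *m \mxcol_v spread g k' v]%SET|
     * 2 ^ \rank (cutmx q E n (srcset A)) <= #|{ffun K -> 'cV['F_2]_q}|)%N.
Proof.
move=> kinj kk' kA; set G := cutmx q E n (srcset A).
pose d g v := spread g k v - spread g k' v.
have dD g h v : d (g + h) v = d g v + d h v.
  by rewrite /d /spread; case: unlift => [i|]; rewrite ?ffunE ?subr0 ?addr0 // addrACA opprD.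
pose f g := G *m \mxcol_v d g v.
have fD : {morph f : x y / x + y}.
  move=> g h; rewrite /f -mulmxDr -mxcolD; congr (_ *m _).
  by apply: eq_mxcol => v; exact: dD.
apply: leq_trans (card_kernel_image fD); apply: leq_mul.
  apply: eq_leq; apply: eq_card => g; rewrite !inE -subr_eq0 -mulmxBr.
  by rewrite /f mxcolB.
have := card_mulmx_image G; rewrite card_Fp // => <-; apply: subset_leq_card.
apply/fintype.subsetP => _ /imsetP[u _ ->].
(* [g] takes the blocks of [u] at the keys [k i] with [i] in [A] and vanishes elsewhere, in
   particular at every [k' i] with [i] in [A]. *)
pose g : {ffun K -> 'cV['F_2]_q} := [ffun x =>
  if [pick i in A | k i == x] is Some i then submxcol u (src i) else 0].
apply/imsetP; exists g => //; rewrite /f -[u in LHS]submxcolK.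
apply/eq_mul_cutmx => j _; apply: eq_cut_receive => _ /imsetP[i iA ->].
rewrite /d /spread unlift_src !ffunE.
case: pickP => [i' /andP[_ /eqP/kinj ->]|/(_ i)]; last by rewrite iA eqxx.
case: pickP => [i'' /andP[i''A /eqP e]|]; last by rewrite subr0.
by move: (kA _ i''A); rewrite {2}(kk' _ _ e) e eqxx.
Qed.
End RandomStep.

(** * Codes given by tables, and the potential of a pair of messages *)

Section TableCode.
Variables (R : realType) (N q : nat) (E : rel (node N)) (n : node N -> node N -> nat).
Variables (T : nat) (Rt : 'rV[R]_N).
Notation V := 'cV['F_2]_q.
Implicit Types (w : msgs T Rt) (h : seq (node N -> V)).

(* All that a source may know: its index, its message and its past receptions,
   padded with zeros up to length [T]. *)
Definition key : finType :=
  {i : 'I_N & ('I_(msize T (Rt 0 i)) * {ffun 'I_T -> V})%type}.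

Definition node_key w h (i : 'I_N) : key :=
  Tagged (fun i => ('I_(msize T (Rt 0 i)) * {ffun 'I_T -> V})%type)
    (w i, [ffun s : 'I_T => nth (@y0 N q) h s (src i)]).

Definition table_code (e : nat -> {ffun key -> V}) (d : ('I_T -> V) -> msgs T Rt) :
    Defs.code q T Rt :=
  Code (fun i t m past => e t
    (Tagged (fun i => ('I_(msize T (Rt 0 i)) * {ffun 'I_T -> V})%type)
      (m, [ffun s : 'I_T => oapp past 0 (insub (s : nat))]))) d.

Lemma transmit_table e d w h : (size h < T)%N ->
  transmit (table_code e d) w h = spread (e (size h)) (node_key w h).
Proof.
move=> hT; apply: boolp.funext => v; rewrite /transmit /spread.
elim/node_ind: v => [|i]; first by rewrite unlift_none.
rewrite unlift_src; case: insubP => [t _ tE|]; last by rewrite hT.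
rewrite /= tE; congr (e _ (Tagged _ (_, _))); apply/ffunP => s; rewrite !ffunE.
case: insubP => [s' _ <- //|]; rewrite -leqNgt => sh.
by rewrite nth_default.
Qed.

(** Causality: the table of time [t] may be chosen after the earlier ones, and the decoder after all
    tables. *)
Lemma eq_hist_table e e' d d' w (t : nat) :
  (forall s, (s < t)%N -> e s = e' s) ->
  hist E n (table_code e d) w t = hist E n (table_code e' d') w t.
Proof.
elim: t => [//|t IH] ee; rewrite /= -IH => [|s st]; last by apply: ee; exact: ltnW.
congr (rcons _ (receive _ _ _)); apply: boolp.funext => v.
rewrite /transmit; case: unlift => [i|//]; case: insubP => [t' _ tE|//].
by rewrite /= tE size_hist ee.
Qed.

Definition same_at (v : node N) h h' : bool :=
  [forall s : 'I_T, nth (@y0 N q) h s v == nth (@y0 N q) h' s v].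

Lemma same_at_rcons v h h' (y y' : node N -> V) :
  size h = size h' -> (size h < T)%N ->
  same_at v (rcons h y) (rcons h' y') = same_at v h h' && (y v == y' v).
Proof.
move=> hh hT; apply/forallP/andP => [e|[/forallP e /eqP yy] s].
  split; last first.
    by have := e (Ordinal hT); rewrite /= !nth_rcons -hh ltnn eqxx.
  apply/forallP => s; case: (ltnP s (size h)) => sh.
    by have := e s; rewrite !nth_rcons -hh sh.
  by rewrite !nth_default -?hh.
have := e s; rewrite !nth_rcons -hh; case: ltnP => // _ _.
by case: (s =P size h :> nat) => // _; rewrite yy.
Qed.

Lemma node_key_inj w h : injective (node_key w h).
Proof. by move=> i j /(congr1 (@tag _ _)). Qed.

Lemma eq_node_key w w' h h' i :
  (node_key w h i == node_key w' h' i) = (w i == w' i) && same_at (src i) h h'.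
Proof.
rewrite /node_key eq_Tagged /= xpair_eqE; congr (_ && _).
apply/eqP/forallP => [/ffunP e s|e]; first by have := e s; rewrite !ffunE => ->.
by apply/ffunP => s; rewrite !ffunE; exact/eqP.
Qed.

Definition distinguish w w' h h' : {set 'I_N} :=
  [set i | node_key w h i != node_key w' h' i]%SET.

Definition msg_diff w w' : {set 'I_N} := [set i | w i != w' i]%SET.

Lemma msg_diff_sub w w' h h' : msg_diff w w' \subset distinguish w w' h h'.
Proof.
by apply/fintype.subsetP => i; rewrite !inE eq_node_key => /negPf ->.
Qed.

Definition potential (kap al : R) (k : nat) w w' h h' : R :=
  if same_at (dest N) h h' then kap ^+ #|distinguish w w' h h'| * al ^+ k else 0.

Local Opaque cutmx receive shiftM.

(** If the signals crossing the cut around [A] differ, some node outside [A] receives different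
    vectors. If it is the destination, the potential drops to 0; otherwise a source joins the set,
    which gains a factor [kap]. *)
Lemma potential_rcons (kap al : R) (k : nat) w w' h h' (g : {ffun key -> V}) :
  0 < kap -> kap <= 1 -> 0 <= al -> size h = size h' -> (size h < T)%N ->
  potential kap al k w w'
    (rcons h (receive E n (spread g (node_key w h))))
    (rcons h' (receive E n (spread g (node_key w' h'))))
  <= kap ^+ (#|distinguish w w' h h'|
       + (cutmx q E n (srcset (distinguish w w' h h'))
            *m \mxcol_v spread g (node_key w h) v
          != cutmx q E n (srcset (distinguish w w' h h'))
            *m \mxcol_v spread g (node_key w' h') v)) * al ^+ k.
Proof.
move=> k0 k1 al0 hh hT.
set A := distinguish w w' h h'; set G := cutmx q E n (srcset A); rewrite /potential.
set y := receive _ _ _; set y' := receive _ _ _.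
case: ifPn => [|_]; last by rewrite mulr_ge0 ?exprn_ge0 // ltW.
rewrite same_at_rcons // => /andP[_ /eqP yd].
rewrite ler_wpM2r ?exprn_ge0 //; apply: ler_wiXn2l => //; first exact: ltW.
set A' := distinguish _ _ _ _.
have sub : A \subset A'.
  apply/fintype.subsetP => i; rewrite !inE !eq_node_key same_at_rcons // !negb_and.
  by case/orP=> ->; rewrite ?orbT.
case: eqP => [_|ne]; first by rewrite addn0 subset_leq_card.
rewrite addn1; apply: proper_card; rewrite finset.properEneq sub andbT.
apply/eqP => AA; apply: ne; apply/eq_mul_cutmx => j jA.
have yj : y j = y' j.
  elim/node_ind: j jA => [//|i]; rewrite mem_srcset AA => iA.
  move: iA; rewrite inE negbK eq_node_key same_at_rcons // => /andP[_ /andP[_]].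
  by move=> /eqP.
(* Sources outside [A] have equal keys and send the same vector, so their contributions cancel. *)
have off : cut_receive E n (~: srcset A) (spread g (node_key w h)) j
         = cut_receive E n (~: srcset A) (spread g (node_key w' h')) j.
  apply: eq_cut_receive => v; elim/node_ind: v => [|i].
    by rewrite /spread unlift_none.
  rewrite inE mem_srcset /spread unlift_src inE negbK => /eqP -> //.
move: yj; rewrite /y /y' (receive_split E n (srcset A) (spread g (node_key w h))).
rewrite (receive_split E n (srcset A) (spread g (node_key w' h'))) off.
exact: addIr.
Qed.

(** The supermartingale inequality: the factor gained is at most 1 on [Z], a fraction at most 2 ^ -
    rank of all tables, and at most [kap] elsewhere. *)
Lemma sum_potential_rcons (kap al : R) (k : nat) w w' h h' :
  0 < kap -> kap <= 1 -> 0 <= al -> size h = size h' -> (size h < T)%N ->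
  (forall A : {set 'I_N}, msg_diff w w' \subset A ->
     kap + (2 ^+ \rank (cutmx q E n (srcset A)))^-1 <= al) ->
  \sum_(g : {ffun key -> V})
    potential kap al k w w'
      (rcons h (receive E n (spread g (node_key w h))))
      (rcons h' (receive E n (spread g (node_key w' h'))))
  <= #|{ffun key -> V}|%:R * potential kap al k.+1 w w' h h'.
Proof.
move=> k0 k1 al0 hh hT rk.
have [same|nsame] := boolP (same_at (dest N) h h'); last first.
  rewrite /potential (negPf nsame) mulr0 big1 // => g _.
  by rewrite same_at_rcons // (negPf nsame).
rewrite [X in _ * X]/potential same.
set A := distinguish w w' h h'; set G := cutmx q E n (srcset A).
pose Z := [set g | G *m \mxcol_v spread g (node_key w h) v
              == G *m \mxcol_v spread g (node_key w' h') v]%SET.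
apply: (@le_trans _ _ (\sum_(g : {ffun key -> V})
   kap ^+ #|A| * al ^+ k * ((g \in Z)%:R + kap))).
  apply: ler_sum => g _; apply: le_trans (potential_rcons _ _ _ _ k0 k1 al0 hh hT) _.
  rewrite -/A -/G inE exprD mulrAC.
  apply: ler_wpM2l; first by rewrite mulr_ge0 ?exprn_ge0 // ltW.
  by case: (_ == _); rewrite /= ?expr0 ?expr1 ?add0r // lerDl ltW.
have ZG : (#|Z|%:R : R) <= #|{ffun key -> V}|%:R * (2 ^+ \rank G)^-1.
  rewrite ler_pdivlMr ?exprn_gt0 // -natrX -natrM ler_nat.
  apply: card_confusing.
  - exact: node_key_inj.
  - by move=> i j /(congr1 (@tag _ _)).
  - by move=> i; rewrite inE.
have ZE : \sum_(g : {ffun key -> V}) (g \in Z)%:R = #|Z|%:R :> R.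
  rewrite -sum1_card natr_sum [RHS]big_mkcond /=; apply: eq_bigr => g _.
  by case: (g \in Z).
rewrite -mulr_sumr big_split /= ZE sumr_const exprSr.
rewrite [X in _ <= X](_ : _ = kap ^+ #|A| * al ^+ k * (#|{ffun key -> V}|%:R * al)); last first.
  by rewrite [RHS]mulrCA !mulrA.
apply: ler_wpM2l; first by rewrite mulr_ge0 ?exprn_ge0 // ltW.
apply: (@le_trans _ _ (#|{ffun key -> V}|%:R * (kap + (2 ^+ \rank G)^-1))).
  by rewrite mulrDr addrC -[kap *+ _]mulr_natl lerD.
by rewrite ler_wpM2l // rk // msg_diff_sub.
Qed.

End TableCode.

(** * Greedy random coding *)

Lemma exists_le_mean (R : realType) (X : finType) (f : X -> R) (c : R) :
  (0 < #|X|)%N -> \sum_x f x <= #|X|%:R * c -> exists x, f x <= c.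
Proof.
move=> X0 le_mean; apply: boolp.contrapT => /boolp.forallNP gt_c.
have lt_c x : c < f x by rewrite ltNge; apply/negP; exact: gt_c.
have : \sum_(x : X) c < \sum_x f x.
  apply: ltr_sum => //; have /card_gt0P[x _] := X0.
  by apply/hasP; exists x; rewrite ?mem_index_enum.
by rewrite sumr_const -mulr_natl ltNge le_mean.
Qed.

Section RandomCoding.
Variables (R : realType) (N q : nat) (E : rel (node N)) (n : node N -> node N -> nat).
Variables (T : nat) (Rt : 'rV[R]_N).
Variables (kap al : {set 'I_N} -> R).
Notation V := 'cV['F_2]_q.
Implicit Types w : msgs T Rt.

(* The sets on which two distinct message tuples may differ. *)
Definition confusable (S : {set 'I_N}) : bool :=
  (S != finset.set0) && [forall i in S, (1 < msize T (Rt 0%R i))%N].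

Hypothesis kap_gt0 : forall S, confusable S -> 0 < kap S.
Hypothesis kap_le1 : forall S, confusable S -> kap S <= 1.
Hypothesis al_ge0 : forall S, confusable S -> 0 <= al S.
Hypothesis cut_le : forall S A : {set 'I_N}, confusable S -> S \subset A ->
  kap S + (2 ^+ \rank (cutmx q E n (srcset A)))^-1 <= al S.

Lemma confusable_diff w w' : w != w' -> confusable (msg_diff w w').
Proof.
move=> ww; apply/andP; split.
  apply: contraNneq ww => d0; apply/eqP/ffunP => i; apply/eqP.
  by move/setP/(_ i): d0; rewrite !inE => /negbFE.
apply/forall_inP => i; rewrite inE => wi.
case: (msize T (Rt 0%R i)) (w i) (w' i) wi => [[]//|[|//]] x y.
by rewrite (ord1 x) (ord1 y) eqxx.
Qed.

(** For fixed [w], the tuples are grouped by the set [S] where they differ from [w]; off [S] they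
    agree with [w], so only the messages in [S] are free. *)
Lemma sum_msg_diff (F : {set 'I_N} -> R) :
  (forall S, confusable S -> 0 <= F S) ->
  \sum_(p : msgs T Rt * msgs T Rt | p.1 != p.2) F (msg_diff p.1 p.2)
  <= #|{: msgs T Rt}|%:R
     * \sum_(S | confusable S) F S * (\prod_(i in S) msize T (Rt 0%R i))%:R.
Proof.
move=> F0.
rewrite -(pair_big_dep xpredT (fun w w' => w != w') (fun w w' => F (msg_diff w w'))) /=.
rewrite mulr_natl -sumr_const; apply: ler_sum => w _.
rewrite (partition_big (msg_diff w) confusable) /=; last exact: confusable_diff.
apply: ler_sum => S cS.
rewrite (eq_bigr (fun=> F S)); last by move=> w' /andP[_ /eqP ->].
rewrite sumr_const -[leLHS]mulr_natr; apply: ler_wpM2l; first exact: F0.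
rewrite ler_nat.
rewrite -[X in (_ <= X)%N](_ : (\prod_(i in ~: ~: S) #|'I_(msize T (Rt 0%R i))|)%N = _); last first.
  by rewrite finset.setCK; apply: eq_bigr => i _; rewrite card_ord.
rewrite -(card_dffun_fix (~: S)%SET w); apply: subset_leq_card.
apply/fintype.subsetP => w' /andP[_ /eqP dS]; rewrite inE.
apply/forall_inP => i; rewrite inE -dS inE negbK => /eqP ->.
exact: eqxx.
Qed.

(** The method of conditional expectations. The weight [kap] ^ -N makes every pair still confused at
    time [T] count at least 1. *)
Lemma exists_table (d : ('I_T -> V) -> msgs T Rt) (t : nat) : (t <= T)%N ->
  exists e : nat -> {ffun key q T Rt -> V},
    \sum_(p : msgs T Rt * msgs T Rt | p.1 != p.2)
      (kap (msg_diff p.1 p.2) ^+ N)^-1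
      * potential (kap (msg_diff p.1 p.2)) (al (msg_diff p.1 p.2)) (T - t) p.1 p.2
          (hist E n (table_code e d) p.1 t) (hist E n (table_code e d) p.2 t)
    <= \sum_(p : msgs T Rt * msgs T Rt | p.1 != p.2)
      (kap (msg_diff p.1 p.2) ^+ N)^-1 * al (msg_diff p.1 p.2) ^+ T.
Proof.
elim: t => [_|t IH tT].
  exists (fun _ => [ffun=> 0]); apply: ler_sum => p /confusable_diff cp.
  rewrite ler_wpM2l ?invr_ge0 ?exprn_ge0 ?(ltW (kap_gt0 cp)) //.
  rewrite /potential subn0; case: ifP => _; last by rewrite exprn_ge0 ?al_ge0.
  by rewrite ler_piMl ?exprn_ge0 ?al_ge0 // exprn_ile1 ?kap_le1 // ltW // kap_gt0.
have [e le_e] := IH (ltnW tT).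
(* Only the table of time [t] is still free, and some choice of it does no worse than the
   average. *)
pose upd (g : {ffun key q T Rt -> V}) s := if s == t then g else e s.
suff [g le_g] : exists g : {ffun key q T Rt -> V},
    \sum_(p : msgs T Rt * msgs T Rt | p.1 != p.2)
      (kap (msg_diff p.1 p.2) ^+ N)^-1
      * potential (kap (msg_diff p.1 p.2)) (al (msg_diff p.1 p.2)) (T - t.+1) p.1 p.2
          (hist E n (table_code (upd g) d) p.1 t.+1)
          (hist E n (table_code (upd g) d) p.2 t.+1)
    <= \sum_(p : msgs T Rt * msgs T Rt | p.1 != p.2)
      (kap (msg_diff p.1 p.2) ^+ N)^-1
      * potential (kap (msg_diff p.1 p.2)) (al (msg_diff p.1 p.2)) (T - t) p.1 p.2
          (hist E n (table_code e d) p.1 t) (hist E n (table_code e d) p.2 t).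
  by exists (upd g); exact: le_trans le_g le_e.
apply: exists_le_mean; first by apply/card_gt0P; exists [ffun=> 0].
rewrite exchange_big mulr_sumr; apply: ler_sum => p /confusable_diff cp.
rewrite -mulr_sumr mulrCA.
apply: ler_wpM2l; first by rewrite invr_ge0 exprn_ge0 ?(ltW (kap_gt0 cp)).
have stepE g w : hist E n (table_code (upd g) d) w t.+1
    = rcons (hist E n (table_code e d) w t)
        (receive E n (spread g (node_key w (hist E n (table_code e d) w t)))).
  rewrite [LHS]/= (@eq_hist_table _ _ _ _ _ _ _ _ e _ d) => [|s st]; last first.
    by rewrite /upd ltn_eqF.
  by rewrite transmit_table size_hist // /upd eqxx.
under eq_bigr do rewrite !stepE.
rewrite -(subnSK tT); apply: sum_potential_rcons; rewrite ?size_hist ?kap_gt0 ?kap_le1 ?al_ge0 //.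
by move=> A; exact: cut_le.
Qed.

(** The decoder returns any tuple compatible with the output, so an error at [w] yields a confused
    pair; such pairs number at most the final weighted potential. *)
Lemma exists_code (w0 : msgs T Rt) :
  exists c : Defs.code q T Rt,
    err_prob E n c <= \sum_(S | confusable S)
      (kap S ^+ N)^-1 * al S ^+ T * (\prod_(i in S) msize T (Rt 0%R i))%:R.
Proof.
(* The constant decoder is a placeholder: outputs do not depend on it. *)
have [e le_e] := exists_table (fun=> w0) (leqnn T).
pose c0 := table_code e (fun=> w0).
pose d (y : 'I_T -> V) :=
  odflt w0 [pick w | [forall t, dest_output E n c0 w t == y t]].
pose c := table_code e d; exists c.
have outE w : dest_output E n c w = dest_output E n c0 w.
  apply: boolp.funext => t; rewrite /dest_output.
  by rewrite (@eq_hist_table _ _ _ _ _ _ _ _ e _ (fun=> w0)).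
pose B := [set p : msgs T Rt * msgs T Rt | (p.1 != p.2)
  && same_at T (dest N) (hist E n c0 p.1 T) (hist E n c0 p.2 T)]%SET.
rewrite /err_prob ler_pdivrMr ?ltr0n; last by apply/card_gt0P; exists w0.
rewrite mulrC; apply: le_trans (sum_msg_diff _); last first.
  by move=> S cS; rewrite mulr_ge0 ?invr_ge0 ?exprn_ge0 ?al_ge0 ?(ltW (kap_gt0 cS)).
apply: le_trans le_e; apply: (@le_trans _ _ (#|B|%:R)).
  rewrite ler_nat -(card_imset _ (_ : injective (fun w => (w, dec c (dest_output E n c w))))).
    apply: subset_leq_card; apply/fintype.subsetP => _ /imsetP[w + ->].
    rewrite !inE /= eq_sym outE => -> /=; rewrite /d.
    case: pickP => [w' /forallP e'|/(_ w)/forallP[]//].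
    by apply/forallP => t; rewrite eq_sym; exact: e'.
  by apply: (can_inj (g := fst)) => w.
rewrite -sum1_card natr_sum big_mkcond [leRHS]big_mkcond /=; apply: ler_sum => p _.
rewrite inE; case: ifPn => [/andP[pp same]|].
  rewrite pp /potential same subnn expr0 mulr1 mulrC.
  have cp := confusable_diff pp.
  rewrite ler_pdivlMr ?exprn_gt0 ?kap_gt0 // mul1r.
  apply: ler_wiXn2l; [exact: ltW (kap_gt0 cp)|exact: kap_le1|].
  by rewrite -[X in (_ <= X)%N](card_ord N) max_card.
move=> _; case: ifPn => // /confusable_diff cp.
rewrite mulr_ge0 ?invr_ge0 ?exprn_ge0 ?(ltW (kap_gt0 cp)) // /potential.
by case: ifP => _; rewrite // mulr_ge0 ?exprn_ge0 ?al_ge0 ?(ltW (kap_gt0 cp)).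
Qed.
End RandomCoding.

(** * Rates and capacity *)

Section Rates.
Variable R : realType.
Implicit Types r : R.

Lemma prod_powR2 (I : finType) (P : pred I) (f : I -> R) :
  \prod_(i | P i) 2 `^ f i = 2 `^ (\sum_(i | P i) f i).
Proof.
rewrite (big_morph (powR 2) (op1 := *%R) (id1 := 1)) ?powRr0 // => x y.
by rewrite powRD // pnatr_eq0 implybT.
Qed.

Lemma ltr_powR2 : {homo powR (2 : R) : x y / x < y}.
Proof.
move=> x y xy; rewrite /powR pnatr_eq0 /= ltr_expR ltr_pM2r //.
by rewrite ln_gt0 // ltr1n.
Qed.

Lemma msize_ge (T : nat) r : 2 `^ (T%:R * r) <= (msize T r)%:R.
Proof.
rewrite /msize natr_absz ger0_norm ?ceil_ge //.
by rewrite ceil_ge0 (lt_le_trans _ (powR_ge0 _ _)) ?ltrN10.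
Qed.

Lemma msize_gt0 (T : nat) r : (0 < msize T r)%N.
Proof. by rewrite -(ltr0n R); apply: lt_le_trans (msize_ge T r); exact: powR_gt0. Qed.

(** Rounding up adds less than 1, and 2 ^ (T * r) is at least 1. *)
Lemma msize_le (T : nat) r : 0 <= r -> (msize T r)%:R <= 2 * 2 `^ (T%:R * r).
Proof.
move=> r0; have p1 : 1 <= 2 `^ (T%:R * r).
  by rewrite -[leLHS](powRr0 (2 : R)) ler_powR ?mulr_ge0 // ler1n.
rewrite /msize natr_absz ger0_norm; last first.
  by rewrite ceil_ge0 (lt_le_trans _ (powR_ge0 _ _)) ?ltrN10.
have /andP[+ _] := ceil_itv (2 `^ (T%:R * r)).
rewrite intrB ltrBlDr => /ltW /le_trans -> //.
by rewrite mulr2n mulrDl mul1r lerD2l.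
Qed.

Lemma msize0 (T : nat) : msize T (0 : R) = 1%N.
Proof. by rewrite /msize mulr0 powRr0 ceil1. Qed.

End Rates.

(** * Converse for achievable rates *)

Section Region.
Variables (R : realType) (N q : nat) (E : rel (node N)) (n : node N -> node N -> nat).
Implicit Type Rt : 'rV[R]_N.

Lemma err_prob_ge (T : nat) Rt (c : Defs.code q T Rt) (S : {set 'I_N}) :
  (1 - err_prob E n c) * 2 `^ (T%:R * \sum_(i in S) Rt 0 i)
  <= 2 `^ (T%:R * (\rank (cutmx q E n (srcset S)))%:R).
Proof.
have M0 : 0 < #|{: msgs T Rt}|%:R :> R.
  by rewrite ltr0n card_dffun_prod prodn_gt0 // => i; rewrite card_ord msize_gt0.
set C := [set w : msgs T Rt | dec c (dest_output E n c w) == w]%SET.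
have -> : 1 - err_prob E n c = #|C|%:R / #|{: msgs T Rt}|%:R.
  rewrite /err_prob -[X in X - _](divff (lt0r_neq0 M0)) -mulrBl.
  have -> : #|[set w | dec c (dest_output E n c w) != w]%classic| = #|~: C|.
    by apply: eq_card => w; apply/idP/idP; rewrite !inE.
  by rewrite -(cardsC C) natrD addrK.
have := card_correct_le E n c S; rewrite -/C -(ler_nat R) !natrM natr_prod => le_C.
rewrite mulrAC ler_pdivrMr // [leRHS]mulrC -natrM powR_mulrn //.
apply: le_trans (le_trans _ le_C) _.
  rewrite ler_wpM2l // mulr_sumr -prod_powR2; apply: ler_prod => i _.
  by rewrite powR_ge0 msize_ge.
by rewrite natrX mulnC.
Qed.

Lemma achievable_cut Rt (S : {set 'I_N}) : achievable q E n Rt ->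
  \sum_(i in S) Rt 0 i <= (\rank (cutmx q E n (srcset S)))%:R.
Proof.
move=> [_ [c err0]]; rewrite leNgt; apply/negP; set r := _%:R => gap.
pose e := \sum_(i in S) Rt 0 i - r; have e0 : 0 < e by rewrite subr_gt0.
have /cvgrPdist_lt /(_ (2^-1)) := err0; case; first by rewrite invr_gt0.
move=> m _ near_err.
(* At block length [k.+1], the first bound puts the error below 1/2 and the second makes 2 ^ ([k.+1]
   * e) at least 2, so (1 - error) * 2 ^ ([k.+1] * e) exceeds 1. *)
pose k := maxn m (Num.bound e^-1).
have := near_err k (leq_maxl _ _); rewrite /= sub0r normrN => /ltr_normlW err_lt.
have := err_prob_ge (c k.+1) S; rewrite -/r; apply/negP; rewrite -ltNge.
have -> : \sum_(i in S) Rt 0 i = r + e by rewrite addrC subrK.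
rewrite mulrDr powRD ?pnatr_eq0 ?implybT //.
rewrite mulrCA ltr_pMr ?powR_gt0 //.
apply: (@lt_le_trans _ _ ((1 - err_prob E n (c k.+1)) * 2)).
  by lra.
rewrite ler_wpM2l //.
  by rewrite subr_ge0 (le_trans (ltW err_lt)) // invf_le1 // ler1n.
rewrite -[leLHS]powRr1 // ler_powR ?ler1n //.
rewrite -ler_pdivrMr // mul1r.
apply: le_trans (ltW (archi_boundP _)) _; first by rewrite invr_ge0 ltW.
by rewrite ler_nat (leq_trans (leq_maxr m _)).
Qed.

End Region.

(** * Achievability of slightly scaled rates *)

Section Achievability.
Variables (R : realType) (N q : nat) (E : rel (node N)) (n : node N -> node N -> nat).
Variables (Rt : 'rV[R]_N) (delta : R).
Hypothesis Rt_ge0 : forall i, 0 <= Rt 0 i.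
Hypothesis Rt_cut : forall S : {set 'I_N},
  \sum_(i in S) Rt 0 i <= (\rank (cutmx q E n (srcset S)))%:R.
Hypotheses (delta_gt0 : 0 < delta) (delta_lt1 : delta < 1).

Let sig (S : {set 'I_N}) := \sum_(i in S) Rt 0 i.
(** For [sig S] positive, the exponent lies strictly between [(1 - delta) * sig S], so that
    [al S ^+ T] beats the number of messages, and [sig S], so that [kap S] is positive. *)
Let al (S : {set 'I_N}) := 2 `^ (- ((1 - delta / 2) * sig S)).
Let kap (S : {set 'I_N}) := al S - 2 `^ (- sig S).

Let sig_ge0 S : 0 <= sig S. Proof. exact: sumr_ge0. Qed.

Let sig_gt0 (T : nat) (S : {set 'I_N}) :
  confusable T ((1 - delta) *: Rt) S -> 0 < sig S.
Proof.
case/andP => /set0Pn[i iS] /forall_inP big; rewrite /sig (bigD1 i) //=.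
rewrite ltr_pwDl ?sumr_ge0 // lt0r Rt_ge0 andbT; apply/eqP => Ri0.
by have := big i iS; rewrite mxE Ri0 mulr0 msize0.
Qed.

Let kap_gt0 S : 0 < sig S -> 0 < kap S.
Proof.
move=> s0; rewrite subr_gt0 ltr_powR2 // ltrN2 gtr_pMl //.
by rewrite ltrBlDr ltrDl divr_gt0.
Qed.

Let exists_scaled_code (T : nat) : exists c : Defs.code q T ((1 - delta) *: Rt),
  err_prob E n c <= \sum_(S | 0 < sig S)
    ((kap S ^+ N)^-1 * 2 ^+ #|S|) * (2 `^ (- (delta / 2 * sig S))) ^+ T.
Proof.
pose w0 : msgs T ((1 - delta) *: Rt) := [ffun i => Ordinal (msize_gt0 T _)].
have d2 : 0 <= 1 - delta / 2.
  by rewrite subr_ge0 ler_pdivrMr // mul1r (le_trans (ltW delta_lt1)) // ler1n.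
have al_le1 S : al S <= 1.
  by rewrite -[leRHS](powRr0 (2 : R)) ler_powR ?ler1n // oppr_le0 mulr_ge0.
have [||||c le_c] := @exists_code R N q E n T ((1 - delta) *: Rt) kap al _ _ _ _ w0.
- by move=> S /sig_gt0 /kap_gt0.
- by move=> S _; rewrite lerBlDr (le_trans (al_le1 S)) // lerDl powR_ge0.
- by move=> S _; exact: powR_ge0.
(* As [S] lies in [A], [sig S] is at most [sig A], hence at most the rank of the cut around [A]. *)
- move=> S A _ SA; rewrite /kap -addrA gerDl addrC subr_le0 -powR_mulrn // -powRN.
  rewrite ler_powR ?ler1n // lerN2; apply: le_trans (Rt_cut A).
  rewrite /sig [leRHS](big_setID S) /= (finset.setIidPr SA) lerDl.
  exact: sumr_ge0.
(* Being confusable depends on [T]; the sum is enlarged to a fixed index set. *)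
exists c; apply: le_trans le_c _; rewrite big_mkcond [leRHS]big_mkcond /=.
apply: ler_sum => S _; case: ifPn => [cS|_]; last first.
  case: ifPn => // /kap_gt0 k0.
  by rewrite !mulr_ge0 ?invr_ge0 ?exprn_ge0 ?powR_ge0 // ltW.
have s0 := sig_gt0 cS; rewrite s0 -!mulrA.
apply: ler_wpM2l; first by rewrite invr_ge0 exprn_ge0 ?ltW // kap_gt0.
(* The factor 2 ^ |S| pays for rounding up each message count. *)
apply: (@le_trans _ _ (al S ^+ T * (2 ^+ #|S| * 2 `^ (T%:R * ((1 - delta) * sig S))))).
  apply: ler_wpM2l; first by rewrite exprn_ge0 // powR_ge0.
  rewrite natr_prod -prodr_const /sig !mulr_sumr -prod_powR2 -big_split /=.
  apply: ler_prod => i _; rewrite ler0n /= mxE msize_le //.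
  by rewrite mulr_ge0 // subr_ge0 ltW.
rewrite mulrCA; apply: ler_wpM2l => //.
rewrite -!powR_mulrn ?powR_ge0 // -!powRrM -powRD ?pnatr_eq0 ?implybT //.
rewrite ler_powR ?ler1n // le_eqVlt; apply/orP; left; apply/eqP.
by field.
Qed.

(** The error bound is a finite sum of geometric sequences of ratio below 1. *)
Lemma scaled_achievable : achievable q E n ((1 - delta) *: Rt).
Proof.
split=> [i|]; first by rewrite mxE mulr_ge0 // subr_ge0 ltW.
exists (fun T => sval (boolp.cid (exists_scaled_code T))).
pose u (S : {set 'I_N}) (T : nat) := ((kap S ^+ N)^-1 * 2 ^+ #|S|)
   * (2 `^ (- (delta / 2 * sig S))) ^+ T.+1.
apply: (@squeeze_cvgr _ _ _ _ (fun=> 0) (fun T => \sum_(S | 0 < sig S) u S T) _).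
- near=> T; apply/andP; split; first by rewrite /err_prob divr_ge0.
  exact: (svalP (boolp.cid (exists_scaled_code T.+1))).
- exact: cvg_cst.
rewrite -[X in _ --> X](_ : \sum_(S | 0 < sig S) 0 = 0); last by rewrite big1.
apply: cvg_big => [|S s0]; first exact: add_continuous.
rewrite /u.
under eq_fun do rewrite exprS mulrA.
apply: cvg_geometric.
rewrite ger0_norm ?powR_ge0 // -[ltRHS](powRr0 (2 : R)) ltr_powR2 //.
by rewrite oppr_lt0 mulr_gt0 // divr_gt0.
Unshelve. all: by end_near. Qed.

End Achievability.

(** * The capacity region as a closure *)

Theorem theorem1 (R : realType) (N q : nat) (E : rel (node N))
    (n : node N -> node N -> nat) :
  (1 <= q)%N ->
  acyclic E ->
  (forall i j, E i j -> (n i j <= q)%N) ->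
  @capacity_region R N q E n =
  [set Rt : 'rV[R]_N | (forall i, 0 <= Rt 0 i) /\
     forall S : {set 'I_N},
       \sum_(i in S) Rt 0 i <= (\rank (cutmx q E n (srcset S)))%:R].
Proof.
move=> _ _ _; apply/seteqP; split=> Rt /=.
  move=> Rt_cl.
  have near_Rt e : 0 < e -> exists R', achievable q E n R' /\
      forall i, `|Rt 0 i - R' 0 i| < e.
    move=> e0; have [R' [aR' [_ bR']]] := Rt_cl _ (nbhsx_ballx Rt e e0).
    by exists R'; split=> // i; exact: bR'.
  split=> [i|S].
    apply/ler_addgt0Pr => e /near_Rt[R' [[R'0 _] /(_ i)]].
    by have := R'0 i; rewrite ltr_norml => + /andP[+ _]; lra.
  apply/ler_addgt0Pr => e e0.
  (* At most [N] rates enter the sum, so the deviations total at most [e]; the divisor [N.+1] is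
     never zero. *)
  have e1 : 0 < e / N.+1%:R by rewrite divr_gt0.
  have [R' [aR' bR']] := near_Rt _ e1.
  apply: (@le_trans _ _ (\sum_(i in S) (R' 0 i + e / N.+1%:R))).
    apply: ler_sum => i _; rewrite -lerBlDl; apply: le_trans (ler_norm _) _.
    exact: ltW (bR' i).
  rewrite big_split /= lerD ?achievable_cut // sumr_const -[leLHS]mulr_natr.
  rewrite mulrAC ler_pdivrMr // ler_pM2l // ler_nat.
  by rewrite (leq_trans (max_card _)) // card_ord.
move=> [R0 Rcut] B /nbhs_ballP[e /= e0 eB].
(* [M] is positive and bounds every rate, so scaling moves each entry by at most [delta * M], which
   is below [e] for the [delta] chosen next. *)
pose M := 1 + \sum_i Rt 0 i.
have M0 : 0 < M by rewrite ltr_pwDl // sumr_ge0.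
pose delta := e / (e + M).
have eM : 0 < e + M by exact: addr_gt0.
have d0 : 0 < delta by exact: divr_gt0.
have d1 : delta < 1.
  by rewrite ltr_pdivrMr // [ltRHS]mul1r ltrDl.
exists ((1 - delta) *: Rt); split; first exact: scaled_achievable.
apply: eB; split=> // i j; rewrite (ord1 i) /ball /= mxE.
rewrite mulrBl mul1r opprB addrC subrK ger0_norm; last by rewrite mulr_ge0 // ltW.
apply: (@le_lt_trans _ _ (delta * M)).
  apply: ler_wpM2l; first exact: ltW.
  by rewrite /M (bigD1 j) //= addrCA lerDl addr_ge0 // sumr_ge0.
rewrite /delta mulrAC ltr_pdivrMr // ltr_pM2l //.
by move: e0; rewrite -(ltrD2r M) add0r.
Qed.
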